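(* Let $0<\alpha<1$, and let $\gamma_0,\gamma_1$ be real with $\gamma_1\ge0$. The function $$\delta(\zeta)=(1-\zeta)\,(-\gamma_1\zeta-\gamma_0)^{\frac{1-\alpha}{\alpha}}$$ satisfies $\frac1\tau\delta(e^{-\tau})=1+O(\tau^2)$ as $\tau\to0^+$ if and only if $$\gamma_0=-\frac{2-\alpha}{2-2\alpha},\qquad \gamma_1=\frac{\alpha}{2-2\alpha}.$$
   Context: Complex powers are taken with the principal branch. *)

(* Defs.v *)
(* Stdlib reals with Coquelicot's complex numbers. *)
From Stdlib Require Import Reals.
From Coquelicot Require Import Coquelicot.
Open Scope R_scope.

Definition Cexp (z : C) : C :=
  (RtoC (exp (Re z)) * (cos (Im z), sin (Im z)))%C.

(* Values lie in (-PI, PI]; a negative real has argument PI. The value at 0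
   carries no meaning. *)
Definition Carg (z : C) : R :=
  if Rle_dec 0 (Im z) then acos (Re z / Cmod z) else - acos (Re z / Cmod z).

Definition Clog (z : C) : C := (ln (Cmod z), Carg z).

(* Usual convention at 0: 0^0 = 1, and 0^b = 0 for b <> 0. *)
Definition Cpower (z b : C) : C :=
  if Ceq_dec z 0 then (if Ceq_dec b 0 then RtoC 1 else RtoC 0)
  else Cexp (b * Clog z)%C.

Definition delta (alpha gamma0 gamma1 : R) (zeta : C) : C :=
  ((1 - zeta)
   * Cpower (- RtoC gamma1 * zeta - RtoC gamma0) (RtoC ((1 - alpha) / alpha)))%C.

Definition big_O (F : (R -> Prop) -> Prop) (f : R -> C) (g : R -> R) : Prop :=
  exists M : R, F (fun t => Cmod (f t) <= M * Rabs (g t)).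

(* Main.v *)
Require Import Defs.
From Stdlib Require Import Reals Lra.
From Coquelicot Require Import Coquelicot.
Open Scope R_scope.

(** Write [g tau = - gamma1 exp(-tau) - gamma0] and [b = (1 - alpha) / alpha > 0].
    The quantity to be studied is [psi * g^b], where
    [psi tau = (1 - exp(-tau)) / tau = 1 - tau/2 + O(tau^2)].

    If [g] tends to [L = - gamma1 - gamma0 > 0], the power is an ordinary real
    one and the product expands as
    [L^b + (b gamma1 L^(b-1) - L^b / 2) tau + O(tau^2)].  This is [1 + O(tau^2)]
    exactly when [L = 1] and [b gamma1 = 1/2], and these two equations are the
    asserted values of [gamma0] and [gamma1] ([expands_psi_Rpower_iff]).

    For the necessity the other signs of [L] have to be excluded.  Only the
    modulus of the product matters there: it must also be [1 + O(tau^2)], and it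
    equals [psi * |g|^b], in which the argument of the complex power has
    disappeared.  If [L < 0], the same expansion applied to [|g| = - g] yields
    [b gamma1 = - 1/2], against [gamma1 >= 0].  (Moduli alone cannot exclude this
    case without that sign: for [b] an even integer, [g^b] is real and positive.)
    If [L = 0], then [|g|^b] tends to [0] because [b > 0], so the modulus cannot
    tend to [1]. *)

(** * First-order expansions at the right of zero *)

Definition expands (f : R -> R) (a0 a1 : R) : Prop :=
  exists M : R, at_right 0 (fun t => Rabs (f t - (a0 + a1 * t)) <= M * t ^ 2).

Lemma at_right_0_between (r : R) : 0 < r -> at_right 0 (fun t => 0 < t < r).
Proof.
  intros Hr. exists (mkposreal r Hr). intros t Ht Ht0. split; [exact Ht0|].
  change (Rabs (t - 0) < r) in Ht. apply Rabs_def2 in Ht. lra.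
Qed.

Lemma at_right_0_pos : at_right 0 (fun t => 0 < t).
Proof. now exists (mkposreal 1 Rlt_0_1). Qed.

Lemma at_right_of_locally (P : R -> Prop) (x : R) : locally x P -> at_right x P.
Proof. intros [e He]. exists e. auto. Qed.

Lemma expands_ext (f g : R -> R) (a0 a1 : R) :
  at_right 0 (fun t => f t = g t) -> expands f a0 a1 -> expands g a0 a1.
Proof.
  intros E [M HM]. exists M.
  generalize (filter_and _ _ E HM). apply filter_imp.
  intros t [<- H]. exact H.
Qed.

(** A right-hand side [M t^2] may be replaced by a nonnegative multiple, which
    makes the estimates below monotone in the constants. *)
Lemma expands_pos_bound (f : R -> R) (a0 a1 : R) :
  expands f a0 a1 ->
  exists M : R, 0 <= M /\
    at_right 0 (fun t => Rabs (f t - (a0 + a1 * t)) <= M * t ^ 2).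
Proof.
  intros [M HM]. exists (Rabs M). split; [apply Rabs_pos|].
  revert HM. apply filter_imp. intros t H.
  pose proof (Rle_abs M). pose proof (pow2_ge_0 t). nra.
Qed.

(** The difference [d0 + d1 t] of two expansions is at most [M t^2]; letting
    [t] tend to [0] kills [d0], and after division by [t] it kills [d1]. *)
Lemma expands_unique (f : R -> R) (a0 a1 c0 c1 : R) :
  expands f a0 a1 -> expands f c0 c1 -> a0 = c0 /\ a1 = c1.
Proof.
  intros Ha Hc.
  destruct (expands_pos_bound _ _ _ Ha) as [M [HM0 HM]].
  destruct (expands_pos_bound _ _ _ Hc) as [N [HN0 HN]].
  assert (Hd : at_right 0 (fun t => 0 < t /\
            Rabs ((a0 - c0) + (a1 - c1) * t) <= (M + N) * t ^ 2)).
  { generalize (filter_and _ _ at_right_0_pos (filter_and _ _ HM HN)).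
    apply filter_imp. intros t [Ht [H1 H2]]. split; [exact Ht|].
    apply Rabs_le_between in H1. apply Rabs_le_between in H2.
    apply Rabs_le. lra. }
  set (d0 := a0 - c0) in *. set (d1 := a1 - c1) in *.
  assert (d0 = 0).
  { destruct (Req_dec d0 0) as [|Hne]; [assumption|exfalso].
    assert (Hp : 0 < Rabs d0) by now apply Rabs_pos_lt.
    set (K := M + N + Rabs d1 + 1).
    assert (HK : 0 < K) by (unfold K; pose proof (Rabs_pos d1); lra).
    assert (Hr : 0 < Rmin 1 (Rabs d0 / K)).
    { apply Rmin_pos; [lra|]. now apply Rdiv_lt_0_compat. }
    destruct (filter_ex _ (filter_and _ _ Hd (at_right_0_between _ Hr)))
      as [t [[_ H] [Ht0 Ht]]].
    assert (Ht1 : t < 1) by (eapply Rlt_le_trans; [exact Ht|apply Rmin_l]).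
    assert (HtK : K * t < Rabs d0).
    { assert (t < Rabs d0 / K) by (eapply Rlt_le_trans; [exact Ht|apply Rmin_r]).
      apply Rmult_lt_compat_l with (r := K) in H0; [|lra].
      replace (K * (Rabs d0 / K)) with (Rabs d0) in H0 by (field; lra). exact H0. }
    assert (T : Rabs d0 <= Rabs (d0 + d1 * t) + Rabs d1 * t).
    { replace (Rabs d1 * t) with (Rabs (- (d1 * t)))
        by (rewrite Rabs_Ropp, Rabs_mult, (Rabs_right t); lra).
      eapply Rle_trans; [|apply Rabs_triang].
      right. f_equal. ring. }
    assert ((M + N) * t ^ 2 <= (M + N) * t).
    { apply Rmult_le_compat_l; [lra|nra]. }
    unfold K in HtK. lra. }
  assert (d1 = 0).
  { destruct (Req_dec d1 0) as [|Hne]; [assumption|exfalso].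
    assert (Hp : 0 < Rabs d1) by now apply Rabs_pos_lt.
    set (K := M + N + 1).
    assert (HK : 0 < K) by (unfold K; lra).
    assert (Hr : 0 < Rabs d1 / K) by now apply Rdiv_lt_0_compat.
    destruct (filter_ex _ (filter_and _ _ Hd (at_right_0_between _ Hr)))
      as [t [[_ HH] [Ht0 Ht]]].
    rewrite H, Rplus_0_l, Rabs_mult, (Rabs_right t) in HH by lra.
    apply Rmult_lt_compat_l with (r := K) in Ht; [|lra].
    replace (K * (Rabs d1 / K)) with (Rabs d1) in Ht by (field; lra).
    unfold K in Ht. nra. }
  unfold d0, d1 in *. lra.
Qed.

Lemma expands_mult (f g : R -> R) (a0 a1 c0 c1 : R) :
  expands f a0 a1 -> expands g c0 c1 ->
  expands (fun t => f t * g t) (a0 * c0) (a0 * c1 + a1 * c0).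
Proof.
  intros Ha Hc.
  destruct (expands_pos_bound _ _ _ Ha) as [M [HM0 HM]].
  destruct (expands_pos_bound _ _ _ Hc) as [N [HN0 HN]].
  exists (M * (Rabs c0 + Rabs c1 + N) + (Rabs a0 + Rabs a1) * N
          + Rabs a1 * Rabs c1).
  generalize (filter_and _ _ (at_right_0_between 1 Rlt_0_1)
                             (filter_and _ _ HM HN)).
  apply filter_imp. intros t [[Ht0 Ht1] [H1 H2]].
  set (u := f t - (a0 + a1 * t)) in *. set (v := g t - (c0 + c1 * t)) in *.
  replace (f t * g t - (a0 * c0 + (a0 * c1 + a1 * c0) * t))
    with (u * (c0 + c1 * t + v) + (a0 + a1 * t) * v + a1 * c1 * t ^ 2)
    by (unfold u, v; ring).
  assert (B : forall x y, Rabs (x + y * t) <= Rabs x + Rabs y).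
  { intros x y. eapply Rle_trans; [apply Rabs_triang|].
    rewrite Rabs_mult, (Rabs_right t) by lra. pose proof (Rabs_pos y). nra. }
  assert (Ht2 : 0 <= t ^ 2 <= 1) by nra.
  assert (V : Rabs (c0 + c1 * t + v) <= Rabs c0 + Rabs c1 + N).
  { eapply Rle_trans; [apply Rabs_triang|]. pose proof (B c0 c1).
    assert (N * t ^ 2 <= N) by nra. lra. }
  eapply Rle_trans; [apply Rabs_triang|].
  eapply Rle_trans; [apply Rplus_le_compat_r, Rabs_triang|].
  rewrite !Rabs_mult, (Rabs_right (t ^ 2)) by lra.
  assert (X1 : Rabs u * Rabs (c0 + c1 * t + v)
               <= (M * t ^ 2) * (Rabs c0 + Rabs c1 + N))
    by (apply Rmult_le_compat; auto using Rabs_pos).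
  assert (X2 : Rabs (a0 + a1 * t) * Rabs v
               <= (Rabs a0 + Rabs a1) * (N * t ^ 2))
    by (apply Rmult_le_compat; auto using Rabs_pos).
  lra.
Qed.

(** By the mean value theorem the remainder is [(df c - df 0) t] with
    [0 <= c <= t], and differentiability of [df] at [0] bounds [df c - df 0] by
    a multiple of [c]. *)
Lemma expands_of_derive (f df : R -> R) :
  locally 0 (fun t => is_derive f t (df t)) -> ex_derive df 0 ->
  expands f (f 0) (df 0).
Proof.
  intros [r Hr] [l Hl].
  assert (Hlip : locally 0 (fun c => Rabs (df c - df 0) <= (Rabs l + 1) * Rabs c)).
  { destruct Hl as [_ Hl]. specialize (Hl 0 (fun P H => H) (mkposreal 1 Rlt_0_1)).
    revert Hl. apply filter_imp. intros c Hc.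
    change (Rabs ((df c - df 0) - (c - 0) * l) <= 1 * Rabs (c - 0)) in Hc.
    rewrite Rminus_0_r in Hc.
    replace (df c - df 0) with ((df c - df 0 - c * l) + c * l) by ring.
    eapply Rle_trans; [apply Rabs_triang|]. rewrite Rabs_mult. lra. }
  destruct Hlip as [r' Hr'].
  exists (Rabs l + 1).
  assert (Hm : 0 < Rmin r r') by (apply Rmin_pos; apply cond_pos).
  generalize (at_right_0_between _ Hm). apply filter_imp. intros t [Ht0 Ht].
  pose proof (Rmin_l r r'). pose proof (Rmin_r r r').
  assert (Hball : forall c (e : posreal), 0 <= c <= t -> t < e -> ball 0 e c).
  { intros c e Hc He. change (Rabs (c - 0) < e). apply Rabs_def1; lra. }
  destruct (MVT_gen f 0 t df) as [c [Hc E]].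
  - intros x Hx. rewrite Rmin_left, Rmax_right in Hx by lra.
    apply Hr. apply Hball; lra.
  - intros x Hx. rewrite Rmin_left, Rmax_right in Hx by lra.
    apply continuity_pt_filterlim.
    apply (ex_derive_continuous f). exists (df x). apply Hr. apply Hball; lra.
  - rewrite Rmin_left, Rmax_right in Hc by lra.
    replace (f t - (f 0 + df 0 * t)) with ((df c - df 0) * t) by lra.
    rewrite Rabs_mult, (Rabs_right t) by lra.
    assert (Hb := Hr' c (Hball c r' Hc ltac:(lra))).
    rewrite (Rabs_right c) in Hb by lra.
    pose proof (Rabs_pos l).
    assert ((Rabs l + 1) * c <= (Rabs l + 1) * t) by nra. nra.
Qed.

(** * The two factors *)

Lemma nonneg_of_derive_nonneg (f df : R -> R) :
  f 0 = 0 -> (forall x, is_derive f x (df x)) ->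
  (forall x, 0 <= x -> 0 <= df x) -> forall t, 0 <= t -> 0 <= f t.
Proof.
  intros H0 Hd Hp t Ht.
  destruct (MVT_gen f 0 t df) as [c [Hc E]].
  - intros; apply Hd.
  - intros x _. apply continuity_pt_filterlim.
    apply (ex_derive_continuous f). eexists; apply Hd.
  - rewrite Rmin_left, Rmax_right in Hc by lra.
    pose proof (Hp c ltac:(lra)). nra.
Qed.

(** Each inequality is the integral from [0] to [t] of the preceding one,
    starting from [1 - t <= exp (- t)]. *)
Lemma one_minus_exp_bounds (t : R) : 0 <= t ->
  t - t ^ 2 / 2 <= 1 - exp (- t) <= t - t ^ 2 / 2 + t ^ 3 / 6.
Proof.
  assert (K : forall x, 0 <= x -> 0 <= 1 - exp (- x) - x + x ^ 2 / 2).
  { apply nonneg_of_derive_nonneg with (df := fun x => exp (- x) - 1 + x).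
    - rewrite Ropp_0, exp_0. lra.
    - intros x. auto_derive; [trivial|]. ring_simplify. field.
    - intros x _. pose proof (exp_ineq1_le (- x)). lra. }
  intros Ht. split; [specialize (K t Ht); lra|].
  assert (0 <= t - t ^ 2 / 2 + t ^ 3 / 6 - 1 + exp (- t)); [|lra].
  revert t Ht.
  apply nonneg_of_derive_nonneg
    with (df := fun x => 1 - exp (- x) - x + x ^ 2 / 2).
  - rewrite Ropp_0, exp_0. lra.
  - intros x. auto_derive; [trivial|]. field.
  - intros x Hx. specialize (K x Hx). lra.
Qed.

Definition psi (t : R) : R := (1 - exp (- t)) / t.

Lemma expands_psi : expands psi 1 (- / 2).
Proof.
  exists 1. generalize at_right_0_pos. apply filter_imp. intros t Ht.
  destruct (one_minus_exp_bounds t ltac:(lra)) as [H1 H2].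
  unfold psi.
  replace ((1 - exp (- t)) / t - (1 + - / 2 * t))
    with ((1 - exp (- t) - (t - t ^ 2 / 2)) / t) by (field; lra).
  rewrite Rabs_right.
  - apply Rmult_le_reg_r with t; [exact Ht|].
    replace ((1 - exp (- t) - (t - t ^ 2 / 2)) / t * t)
      with (1 - exp (- t) - (t - t ^ 2 / 2)) by (field; lra).
    assert (0 <= t ^ 3) by (apply pow_le; lra). lra.
  - apply Rle_ge. apply Rle_div_r; lra.
Qed.

Lemma psi_pos_le_1 (t : R) : 0 < t -> 0 < psi t <= 1.
Proof.
  intros Ht. unfold psi. split.
  - apply Rdiv_lt_0_compat; [|exact Ht].
    assert (exp (- t) < exp 0) by (apply exp_increasing; lra).
    rewrite exp_0 in H. lra.
  - apply Rle_div_l; [exact Ht|]. pose proof (exp_ineq1_le (- t)). lra.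
Qed.

Lemma continuous_affine_exp (p q : R) :
  continuous (fun t => p + q * exp (- t)) 0.
Proof. apply (ex_derive_continuous (fun t => p + q * exp (- t))). now auto_derive. Qed.

Lemma affine_exp_at_0 (p q : R) : p + q * exp (- 0) = p + q.
Proof. rewrite Ropp_0, exp_0. ring. Qed.

Lemma affine_exp_locally_pos (p q : R) :
  0 < p + q -> locally 0 (fun t => 0 < p + q * exp (- t)).
Proof.
  intros H. apply (continuous_affine_exp p q). apply open_gt.
  now rewrite affine_exp_at_0.
Qed.

Lemma expands_Rpower (p q b : R) : 0 < p + q ->
  expands (fun t => Rpower (p + q * exp (- t)) b)
    (Rpower (p + q) b) (- (b * q / (p + q) * Rpower (p + q) b)).
Proof.
  intros H.
  set (df := fun t => - (b * (q * exp (- t)) / (p + q * exp (- t))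
                         * Rpower (p + q * exp (- t)) b)).
  assert (E : expands (fun t => Rpower (p + q * exp (- t)) b)
                (Rpower (p + q * exp (- 0)) b) (df 0)).
  { apply expands_of_derive.
    - generalize (affine_exp_locally_pos p q H). apply filter_imp. intros t Ht.
      unfold df, Rpower. auto_derive; [exact Ht|]. field. lra.
    - unfold df, Rpower. auto_derive. rewrite affine_exp_at_0.
      repeat split; lra. }
  unfold df in E. rewrite affine_exp_at_0, Ropp_0, exp_0, Rmult_1_r in E.
  exact E.
Qed.

(** Multiplying the two expansions, the product is [1 + O(t^2)] iff
    [(p + q)^b = 1] and the linear term [- 1/2 - b q / (p + q)] vanishes. *)
Lemma expands_psi_Rpower_iff (p q b : R) : 0 < p + q -> 0 < b ->
  expands (fun t => psi t * Rpower (p + q * exp (- t)) b) 1 0 <->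
  (p + q = 1 /\ b * q = - / 2).
Proof.
  intros H Hb.
  pose proof (expands_mult _ _ _ _ _ _ expands_psi (expands_Rpower p q b H)) as E.
  split.
  - intros E1. destruct (expands_unique _ _ _ _ _ E1 E) as [A0 A1].
    assert (Hpq : p + q = 1).
    { apply ln_inv; [exact H|lra|]. rewrite ln_1.
      assert (L : ln (Rpower (p + q) b) = b * ln (p + q))
        by (unfold Rpower; apply ln_exp).
      replace (Rpower (p + q) b) with 1 in L by lra. rewrite ln_1 in L.
      symmetry in L. apply Rmult_integral in L. lra. }
    split; [exact Hpq|].
    replace (Rpower (p + q) b) with 1 in A1 by lra.
    rewrite Hpq in A1. lra.
  - intros [Hpq Hq].
    assert (P1 : Rpower (p + q) b = 1)
      by (rewrite Hpq; unfold Rpower; rewrite ln_1, Rmult_0_r; apply exp_0).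
    rewrite P1, Hpq in E.
    replace 1 with (1 * 1) by ring.
    replace 0 with (1 * - (b * q / 1 * 1) + - / 2 * 1) by lra.
    exact E.
Qed.

(** * Complex powers of real numbers *)

Lemma Cpower_pos (x b : R) : 0 < x -> Cpower (RtoC x) (RtoC b) = RtoC (Rpower x b).
Proof.
  intros Hx. unfold Cpower.
  destruct (Ceq_dec (RtoC x) 0) as [E|_].
  { apply RtoC_inj in E. lra. }
  unfold Clog, Carg, Cexp. rewrite Cmod_R, (Rabs_right x) by lra. simpl.
  destruct (Rle_dec 0 0) as [_|n]; [|lra].
  replace (x / x) with 1 by (field; lra). rewrite acos_1.
  unfold Rpower.
  replace (b * 0 + 0 * ln x) with 0 by ring.
  replace (b * ln x - 0 * 0) with (b * ln x) by ring.
  rewrite cos_0, sin_0. change (1, 0) with (RtoC 1). ring.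
Qed.

Lemma Cmod_Cpower_real (x b : R) : x <> 0 ->
  Cmod (Cpower (RtoC x) (RtoC b)) = Rpower (Rabs x) b.
Proof.
  intros Hx. unfold Cpower.
  destruct (Ceq_dec (RtoC x) 0) as [E|_].
  { apply RtoC_inj in E. lra. }
  unfold Clog, Cexp. rewrite Cmod_R, Cmod_mult, Cmod_R. simpl.
  set (th := b * Carg (RtoC x) + 0 * ln (Rabs x)).
  replace (Cmod (cos th, sin th)) with 1.
  - rewrite Rmult_1_r, Rabs_right by (left; apply exp_pos).
    unfold Rpower. f_equal. ring.
  - unfold Cmod. simpl fst. simpl snd.
    replace (cos th ^ 2 + sin th ^ 2) with 1; [now rewrite sqrt_1|].
    pose proof (sin2_cos2 th) as S. unfold Rsqr in S. lra.
Qed.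

Lemma Cpower_0_l (b : R) : b <> 0 -> Cpower (RtoC 0) (RtoC b) = RtoC 0.
Proof.
  intros Hb. unfold Cpower.
  destruct (Ceq_dec (RtoC 0) 0) as [_|n]; [|now contradict n].
  destruct (Ceq_dec (RtoC b) 0) as [E|_]; [|reflexivity].
  apply RtoC_inj in E. contradiction.
Qed.

(** The power is continuous at [0] with value [0]; the constant [1/2] is all
    that is required to keep it away from [1]. *)
Lemma Cmod_Cpower_small (b : R) : 0 < b ->
  exists eta : R, 0 < eta /\
    forall x, Rabs x < eta -> Cmod (Cpower (RtoC x) (RtoC b)) <= / 2.
Proof.
  intros Hb. exists (exp (ln (/ 2) / b)). split; [apply exp_pos|].
  intros x Hx. destruct (Req_dec x 0) as [->|Hn].
  - rewrite Cpower_0_l by lra. rewrite Cmod_0. lra.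
  - rewrite Cmod_Cpower_real by exact Hn.
    assert (Hp : 0 < Rabs x) by now apply Rabs_pos_lt.
    apply ln_increasing in Hx; [|exact Hp]. rewrite ln_exp in Hx.
    unfold Rpower. rewrite <- (exp_ln (/ 2)) at 1 by lra.
    left. apply exp_increasing.
    apply Rmult_lt_compat_l with (r := b) in Hx; [|exact Hb].
    replace (b * (ln (/ 2) / b)) with (ln (/ 2)) in Hx by (field; lra).
    exact Hx.
Qed.

(** * The characterization *)

Lemma delta_over_tau (alpha gamma0 gamma1 t : R) : 0 < t ->
  (RtoC (1 / t) * delta alpha gamma0 gamma1 (RtoC (exp (- t))))%C =
  (RtoC (psi t) *
   Cpower (RtoC (- gamma0 + - gamma1 * exp (- t))) (RtoC ((1 - alpha) / alpha)))%C.
Proof.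
  intros Ht. unfold delta.
  replace (- RtoC gamma1 * RtoC (exp (- t)) - RtoC gamma0)%C
    with (RtoC (- gamma0 + - gamma1 * exp (- t)))
    by (rewrite RtoC_plus, RtoC_mult, !RtoC_opp; ring).
  rewrite Cmult_assoc. f_equal.
  rewrite <- RtoC_minus, <- RtoC_mult. f_equal. unfold psi. field. lra.
Qed.

(** Passing to moduli is free in this direction: [|z - 1| >= ||z| - 1|]. *)
Lemma expands_Cmod_of_big_O (F : R -> C) :
  big_O (at_right 0) (fun t => (F t - 1)%C) (fun t => t ^ 2) ->
  expands (fun t => Cmod (F t)) 1 0.
Proof.
  intros [M HM]. exists M. revert HM. apply filter_imp. intros t Ht.
  rewrite (Rabs_right (t ^ 2)) in Ht by (apply Rle_ge, pow2_ge_0).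
  eapply Rle_trans; [|exact Ht].
  rewrite Rmult_0_l, Rplus_0_r.
  pose proof (Cmod_triangle (F t - 1) 1) as H1.
  pose proof (Cmod_triangle (1 - F t) (F t)) as H2.
  replace (F t - 1 + 1)%C with (F t) in H1 by ring.
  replace (1 - F t + F t)%C with (RtoC 1) in H2 by ring.
  replace (1 - F t)%C with (- (F t - 1))%C in H2 by ring.
  rewrite Cmod_opp in H2. rewrite Cmod_1 in H1, H2.
  apply Rabs_le. lra.
Qed.

Theorem lemma4p4 (alpha gamma0 gamma1 : R)
  (Halpha : 0 < alpha < 1) (Hgamma1 : 0 <= gamma1) :
  big_O (at_right 0)
    (fun tau : R =>
       (RtoC (1 / tau) * delta alpha gamma0 gamma1 (RtoC (exp (- tau))) - 1)%C)
    (fun tau : R => tau ^ 2)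
  <->
  (gamma0 = - ((2 - alpha) / (2 - 2 * alpha)) /\
   gamma1 = alpha / (2 - 2 * alpha)).
Proof.
  set (b := (1 - alpha) / alpha).
  assert (Hb : 0 < b) by (apply Rdiv_lt_0_compat; lra).
  assert (Hparam : (gamma0 = - ((2 - alpha) / (2 - 2 * alpha)) /\
                    gamma1 = alpha / (2 - 2 * alpha)) <->
                   (- gamma0 + - gamma1 = 1 /\ b * - gamma1 = - / 2)).
  { unfold b. split.
    - intros [-> ->]. split; field; lra.
    - intros [H0 H1].
      assert (G : gamma1 = alpha / (2 - 2 * alpha)).
      { apply Rmult_eq_reg_l with (- ((1 - alpha) / alpha)); [|unfold b in Hb; lra].
        replace (- ((1 - alpha) / alpha) * gamma1) with (- / 2) by lra.
        field. lra. }
      split; [|exact G].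
      replace gamma0 with (- 1 - gamma1) by lra. rewrite G. field. lra. }
  rewrite Hparam. split.
  - intros HO.
    assert (E : expands (fun t => psi t *
              Cmod (Cpower (RtoC (- gamma0 + - gamma1 * exp (- t))) (RtoC b))) 1 0).
    { apply expands_Cmod_of_big_O in HO. revert HO. apply expands_ext.
      generalize at_right_0_pos. apply filter_imp. intros t Ht.
      rewrite delta_over_tau by exact Ht.
      rewrite Cmod_mult, Cmod_R, Rabs_right; [reflexivity|].
      pose proof (psi_pos_le_1 t Ht). lra. }
    destruct (Rtotal_order (- gamma0 + - gamma1) 0) as [HL|[HL|HL]].
    + (* The base is negative: [|g|] is the affine function with both
         coefficients negated. *)
      exfalso.
      assert (HL' : 0 < gamma0 + gamma1) by lra.
      assert (E' : expands (fun t =>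
                psi t * Rpower (gamma0 + gamma1 * exp (- t)) b) 1 0).
      { revert E. apply expands_ext.
        generalize (at_right_of_locally _ _ (affine_exp_locally_pos _ _ HL')).
        apply filter_imp. intros t Ht.
        rewrite Cmod_Cpower_real by lra.
        rewrite Rabs_left by lra. do 2 f_equal. ring. }
      apply expands_psi_Rpower_iff in E'; [|exact HL'|exact Hb]. nra.
    + exfalso.
      destruct (Cmod_Cpower_small b Hb) as [eta [Heta Hsmall]].
      assert (Hg : at_right 0 (fun t => Rabs (- gamma0 + - gamma1 * exp (- t)) < eta)).
      { apply at_right_of_locally.
        assert (Hc := continuous_affine_exp (- gamma0) (- gamma1)).
        specialize (Hc (fun y => Rabs y < eta)). apply Hc.
        rewrite affine_exp_at_0, HL. exists (mkposreal eta Heta).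
        intros y Hy. change (Rabs (y - 0) < eta) in Hy.
        now rewrite Rminus_0_r in Hy. }
      destruct (expands_pos_bound _ _ _ E) as [M [HM0 HM]].
      (* For [t < 1] and [t < 1 / (2 (M + 1))] one has [M t^2 < 1/2]. *)
      assert (Hr : 0 < Rmin 1 (/ (2 * (M + 1)))).
      { apply Rmin_pos; [lra|]. apply Rinv_0_lt_compat. lra. }
      destruct (filter_ex _ (filter_and _ _ (at_right_0_between _ Hr)
                               (filter_and _ _ Hg HM))) as [t [[Ht0 Ht] [Hgt H]]].
      specialize (Hsmall _ Hgt).
      set (m := Cmod _) in *.
      assert (Hm : 0 <= m) by apply Cmod_ge_0.
      pose proof (psi_pos_le_1 t Ht0).
      assert (psi t * m <= / 2) by nra.
      apply Rabs_le_between in H.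
      assert (t < 1) by (eapply Rlt_le_trans; [exact Ht|apply Rmin_l]).
      assert (Htr : t < / (2 * (M + 1)))
        by (eapply Rlt_le_trans; [exact Ht|apply Rmin_r]).
      apply Rmult_lt_compat_l with (r := 2 * (M + 1)) in Htr; [|lra].
      rewrite Rinv_r in Htr by lra. nra.
    + apply expands_psi_Rpower_iff; [exact HL|exact Hb|].
      revert E. apply expands_ext.
      generalize (at_right_of_locally _ _ (affine_exp_locally_pos _ _ HL)).
      apply filter_imp. intros t Ht.
      rewrite Cmod_Cpower_real, Rabs_right by lra. reflexivity.
  - intros HP.
    assert (HL : 0 < - gamma0 + - gamma1) by lra.
    apply expands_psi_Rpower_iff in HP; [|exact HL|exact Hb].
    destruct HP as [M HM]. exists M.
    generalize (filter_and _ _ at_right_0_pos (filter_and _ _ HM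
      (at_right_of_locally _ _ (affine_exp_locally_pos _ _ HL)))).
    apply filter_imp. intros t [Ht [H Hg]].
    rewrite delta_over_tau by exact Ht. fold b.
    rewrite Cpower_pos by exact Hg.
    rewrite <- RtoC_mult, <- RtoC_minus, Cmod_R.
    rewrite (Rabs_right (t ^ 2)) by (apply Rle_ge, pow2_ge_0).
    rewrite Rmult_0_l, Rplus_0_r in H. exact H.
Qed.
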